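(* Let $f:\mathbb{C}\to\mathbb{C}$ be a transcendental entire function and let $R>0$ be such that $M(r,f)>r$ for all $r\ge R$. Then, for each $L\in\mathbb{Z}$, each connected component of $A_R^L(f)$ is closed and unbounded; in particular, each connected component of $A(f)$ is unbounded.
   Context: $\mathbb{N}=\{1,2,\dots\}$; $f^n$ denotes the $n$th iterate of $f$. $M(r,f)=\max_{|z|=r}|f(z)|$ for $r>0$, and $M^n(r,f)$ denotes the $n$th iterate of the function $r\mapsto M(r,f)$ (so $M^0(r,f)=r$). For $R>0$ such that $M(r,f)>r$ for $r\ge R$ and $L\in\mathbb{Z}$, the $L$th level of $A(f)$ is $A_R^L(f)=\{z: |f^n(z)|\ge M^{n+L}(R,f)\text{ for all } n\in\mathbb{N}\text{ with } n+L\ge 0\}$. The fast escaping set is $A(f)=\{z:\text{there exists } L\in\mathbb{N}\text{ such that } |f^{n+L}(z)|\ge M^n(R,f)\text{ for all } n\in\mathbb{N}\}=\bigcup_{L\in\mathbb{N}}A_R^{-L}(f)$; it does not depend on the choice of such $R$. *)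

(* Defs.v *)
From HB Require Import structures.
From mathcomp Require Import all_boot all_order all_algebra.
From mathcomp Require Import all_classical all_reals all_analysis.
From mathcomp.real_closed Require Export complex.

Set Implicit Arguments.
Unset Strict Implicit.
Unset Printing Implicit Defensive.

Import Order.TTheory GRing.Theory Num.Theory.
Import numFieldNormedType.Exports.
Import ComplexField.

Local Open Scope classical_set_scope.
Local Open Scope ring_scope.
Local Open Scope complex_scope.

(* The regular module R[i]^o, rather than R[i], carries the topology and the
   norm, so [derivable f z 1] below is complex differentiability at z. *)
Notation Cplx R := ((R : realType)[i]^o).

Section FastEscaping.
Variable R : realType.
Implicit Types f : Cplx R -> Cplx R.

(* The norm [`|z|] of R[i] takes its values in R[i]; this is its real part. *)
Definition cmod (z : Cplx R) : R := complex.Re `|z|.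

Definition entire f := forall z : Cplx R, derivable f z 1.

Definition transcendental_entire f :=
  entire f /\ ~ exists p : {poly R[i]}, forall z, f z = p.[z].

(* For continuous f and r >= 0 the supremum is a maximum. *)
Definition maxmod f (r : R) : R :=
  sup [set cmod (f z) | z in [set z | cmod z = r]].

Definition maxmod_iter f (n : nat) (r : R) : R := iter n (maxmod f) r.

(* [absz] only converts the nonnegative integer n + L to a natural number. *)
Definition level f (r : R) (L : int) : set (Cplx R) :=
  [set z | forall n : nat, (1 <= n)%N -> 0 <= n%:Z + L ->
     maxmod_iter f (absz (n%:Z + L)) r <= cmod (iter n f z)].

(* The r-dependence is only formal: the set is the same for all r > 0 such
   that s < maxmod f s for all s >= r. *)
Definition fast_escaping f (r : R) : set (Cplx R) :=
  [set z | exists2 L : nat, (1 <= L)%N &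
     forall n : nat, (1 <= n)%N ->
       maxmod_iter f n r <= cmod (iter (n + L)%N f z)].

Definition components (A : set (Cplx R)) : set (set (Cplx R)) :=
  [set connected_component A z | z in A].

End FastEscaping.

(* Main.v *)
Require Import Defs.
From mathcomp Require Import all_boot all_order all_algebra.
From mathcomp Require Import all_classical all_reals all_analysis.
From mathcomp Require Import ring lra zify.
Import numFieldNormedType.Exports.
Import Order.TTheory GRing.Theory Num.Theory.
Local Open Scope classical_set_scope.
Local Open Scope ring_scope.
Local Open Scope complex_scope.

(* If the component of z in the level A were bounded, boundary bumping (in a
   compact set, components are intersections of relatively clopen sets) would
   give a bounded open W around z whose boundary misses A.  The conditions
   |f^n| >= M^(n+L)(R) defining A become stronger as n grows, because |w| < t
   implies |f(w)| < M(t); by compactness some single f^n thus satisfies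
   |f^n| < M^(n+L)(R) on the whole boundary of W, and the maximum principle
   contradicts |f^n(z)| >= M^(n+L)(R).

   The maximum principle is obtained without integrals.  Goursat's bisection
   applies directly to Riemann sums over boundaries of squares, first for
   functions differentiable on the square, then with one bounded singularity at
   the centre c.  For (g^n - g(c)^n) / (z - c) this gives |g(c)|^n <= 2 q^n for
   all n when |g| <= q on the boundary, hence |g(c)| <= q.  Multiplying g with
   its rotates by right angles about c turns this into a strong local maximum
   principle. *)

Set Implicit Arguments.
Unset Strict Implicit.
Unset Printing Implicit Defensive.

(** * Modulus, topology and complex differentiability on the plane *)

Section ComplexPlane.
Variable R : realType.
Local Notation C := (Cplx R).
Implicit Types (z w : C) (x y e r : R).

Lemma normr_cmod z : `|z| = (cmod z)%:C :> R[i].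
Proof. by case: z => x y; rewrite /cmod; apply/eqP; rewrite eq_complex /= !eqxx. Qed.

Lemma rcD x y : (x + y)%:C = x%:C + y%:C :> C. Proof. exact: rmorphD. Qed.
Lemma rcM x y : (x * y)%:C = x%:C * y%:C :> C. Proof. exact: rmorphM. Qed.
Lemma rcN x : (- x)%:C = - x%:C :> C. Proof. exact: rmorphN. Qed.
Lemma rcV x : x^-1%:C = (x%:C)^-1 :> C. Proof. exact: fmorphV. Qed.
Lemma rcn n : (n%:R : R)%:C = n%:R :> C. Proof. exact: rmorph_nat. Qed.
Lemma rcX x n : (x ^+ n)%:C = x%:C ^+ n :> C. Proof. exact: rmorphXn. Qed.

(** Pushes the embedding of the reals down to atoms, so that [ring] and [field] can work in the
    complex numbers. *)
Definition realcE := (rcD, rcM, rcN, rcV, rcX, rcn).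

Lemma cmod_ge0 z : 0 <= cmod z.
Proof. by rewrite -lecR -normr_cmod normr_ge0. Qed.

Lemma cmod_eq0 z : (cmod z == 0) = (z == 0).
Proof. by rewrite -(@normr_eq0 _ C) normr_cmod eq_complex /= eqxx andbT. Qed.

Lemma cmod_gt0 z : (0 < cmod z) = (z != 0).
Proof. by rewrite lt_def cmod_ge0 andbT cmod_eq0. Qed.

Lemma cmod0 : cmod (0 : C) = 0.
Proof. by apply/eqP; rewrite cmod_eq0. Qed.

Lemma cmod1 : cmod (1 : C) = 1.
Proof. by rewrite /cmod normr1. Qed.

Lemma cmodM z w : cmod (z * w) = cmod z * cmod w.
Proof.
by apply/complexI; rewrite rmorphM /= -!normr_cmod (@normrM R[i]).
Qed.

Lemma cmodV z : cmod z^-1 = (cmod z)^-1.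
Proof. by apply/complexI; rewrite fmorphV /= -!normr_cmod (@normfV R[i]). Qed.

Lemma cmodX z n : cmod (z ^+ n) = cmod z ^+ n.
Proof.
by elim: n => [|n IH]; rewrite ?expr0 ?cmod1// !exprS cmodM IH.
Qed.

Lemma cmodN z : cmod (- z) = cmod z.
Proof. by rewrite /cmod normrN. Qed.

Lemma cmod_distC z w : cmod (z - w) = cmod (w - z).
Proof. by rewrite -cmodN opprB. Qed.

Lemma cmodD z w : cmod (z + w) <= cmod z + cmod w.
Proof.
by rewrite -lecR rmorphD /= -!normr_cmod (@ler_normD R[i] R[i]).
Qed.

Lemma cmod_triangle u z w : cmod (z - w) <= cmod (z - u) + cmod (u - w).
Proof. by rewrite -[z - w](subrKA u) cmodD. Qed.

Lemma cmod_sum n (F : nat -> C) :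
  cmod (\sum_(k < n) F k) <= \sum_(k < n) cmod (F k).
Proof.
elim: n => [|n IH]; first by rewrite !big_ord0 cmod0.
by rewrite !big_ord_recr /= (le_trans (cmodD _ _))// lerD2r.
Qed.

Lemma cmod_real x : cmod (x%:C : C) = `|x|.
Proof. by rewrite /cmod normc_def /= expr0n addr0 sqrtr_sqr. Qed.

Lemma rc_eq0 x : (x%:C == 0 :> C) = (x == 0).
Proof. by rewrite -cmod_eq0 cmod_real normr_eq0. Qed.

Lemma cmod_nat n : cmod (n%:R : C) = n%:R.
Proof. by rewrite -rcn cmod_real normr_nat. Qed.

Lemma cmod_sqr z : cmod z ^+ 2 = complex.Re z ^+ 2 + complex.Im z ^+ 2.
Proof.
case: z => x y; rewrite /cmod normc_def /= sqr_sqrtr//.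
by rewrite addr_ge0 ?sqr_ge0.
Qed.

Lemma ReIm_le_cmod z : `|complex.Re z| <= cmod z /\ `|complex.Im z| <= cmod z.
Proof.
split; rewrite -(@ler_pXn2r _ 2)// ?nnegrE ?cmod_ge0//;
  rewrite -normrX ger0_norm ?sqr_ge0// cmod_sqr.
- by rewrite lerDl sqr_ge0.
- by rewrite lerDr sqr_ge0.
Qed.

Definition ci : C := 'i.

Lemma ci_sqr : ci * ci = -1.
Proof. by apply/eqP; rewrite /ci; simpc. Qed.

Lemma cmod_ci : cmod ci = 1.
Proof. by rewrite /cmod normc_def /= expr0n expr1n add0r sqrtr1. Qed.

(** The radii of balls are elements of [R[i]]; a positive one has zero imaginary part, so real radii
    suffice. *)
Lemma nbhs_cmodP z (P : set C) :
  nbhs z P <-> exists2 e : R, 0 < e & forall w, cmod (w - z) < e -> P w.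
Proof.
split => [/nbhs_ballP[e /= e0 eP]|[e e0 eP]].
  have er : e = (complex.Re e)%:C.
    by move: e0; rewrite ltcE /= => /andP[/eqP ei _]; case: e eP ei => a b _ /= ->.
  exists (complex.Re e); first by rewrite -ltcR -er.
  move=> w wz; apply: eP; rewrite -ball_normE /ball_ /= distrC normr_cmod er.
  by rewrite ltcR.
apply/nbhs_ballP; exists e%:C; rewrite /= ?ltcR// => w.
by rewrite -ball_normE /ball_ /= distrC normr_cmod ltcR; exact: eP.
Qed.

Lemma cvg_cmodP (T : Type) (F : set_system T) {FF : Filter F} (f : T -> C) (l : C) :
  f @ F --> l <-> forall e : R, 0 < e -> \forall t \near F, cmod (f t - l) < e.
Proof.
split=> [fl e e0|fl].
  have := fl [set w | cmod (w - l) < e]; apply.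
  by apply/nbhs_cmodP; exists e.
move=> P /nbhs_cmodP[e e0 eP]; rewrite nbhs_simpl /=.
by apply: (@filterS _ F _ _ _ _ (fl _ e0)) => t /=; exact: eP.
Qed.

Lemma continuous_cmodP (f : C -> C) z :
  {for z, continuous f} <->
  forall e : R, 0 < e -> exists2 d : R, 0 < d &
    forall w, cmod (w - z) < d -> cmod (f w - f z) < e.
Proof.
have H := @cvg_cmodP C (nbhs z) (nbhs_filter z) f (f z).
split=> [/H fz e /fz /nbhs_cmodP//|fz].
by apply/H => e /fz ?; apply/nbhs_cmodP.
Qed.

Lemma cmod_continuous : continuous (@cmod R).
Proof.
move=> z; apply/(@cvgrPdist_lt _ R^o C (nbhs z) (nbhs_filter z)) => e e0.
apply/nbhs_cmodP; exists e => // w wz.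
apply: le_lt_trans wz; rewrite ler_norml; apply/andP; split.
  by rewrite lerNl opprB lerBlDr -[X in cmod X <= _](subrK z) cmodD.
by rewrite lerBlDr cmod_distC -[X in cmod X <= _](subrK w) cmodD.
Qed.

Lemma closed_cmod_le r : closed [set z : C | cmod z <= r].
Proof.
apply: (@preimage_closed _ _ (@cmod R) [set x | x <= r]) => //.
  by move=> z _; exact: cmod_continuous.
Qed.

(** The disc is a closed subset of the continuous image of a compact square of the real plane. *)
Lemma compact_cmod_le r : compact [set z : C | cmod z <= r].
Proof.
pose I := `[- r, r]%classic.
pose h (p : R * R) : C := p.1 +i* p.2.
have hc : continuous h.
  move=> p; apply/cvg_cmodP => e e0.
  have e2 : 0 < e / 2 by rewrite divr_gt0.
  have p1 : \forall q \near p, `|p.1 - q.1| < e / 2.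
    have H : fst @ p --> p.1 by case: (p) => a b; exact: cvg_fst.
    by have /cvgrPdist_lt := H; exact.
  have p2 : \forall q \near p, `|p.2 - q.2| < e / 2.
    have H : snd @ p --> p.2 by case: (p) => a b; exact: cvg_snd.
    by have /cvgrPdist_lt := H; exact.
  near=> q.
  have -> : h q - h p = (q.1 - p.1)%:C + 'i * (q.2 - p.2)%:C.
    by rewrite /h /=; simpc.
  apply: (le_lt_trans (cmodD _ _)); rewrite cmodM !cmod_real.
  rewrite -/ci cmod_ci mul1r [e]splitr distrC (distrC q.2).
  by apply: ltrD; near: q.
have /(@subclosed_compact _ _ _ (@closed_cmod_le r)) : compact (h @` (I `*` I)).
  apply: continuous_compact; first exact/continuous_subspaceT.
  by apply: compact_setX; exact: segment_compact.
apply => z zr; exists (complex.Re z, complex.Im z); last by case: z {zr}.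
have [Rz Iz] := ReIm_le_cmod z.
by split; rewrite /I /= in_itv /= -ler_norml (le_trans _ zr).
Unshelve. all: by end_near. Qed.

Lemma bounded_closed_compactC (K : set C) r :
  closed K -> (forall z, K z -> cmod z <= r) -> compact K.
Proof.
by move=> Kc Kr; apply: (subclosed_compact Kc (@compact_cmod_le r)) => z /Kr.
Qed.

Lemma bounded_cmodP (K : set C) :
  bounded_set K <-> exists r : R, forall z, K z -> cmod z <= r.
Proof.
split=> [[M [Mr MK]]|[r rK]].
  have ME : M = (complex.Re M)%:C.
    by move/complex_realP: Mr => [x ->].
  exists (complex.Re M + 1) => z Kz.
  rewrite -lecR -normr_cmod; apply: (MK (complex.Re M + 1)%:C _ z Kz).
  by rewrite [X in X < _]ME ltcR ltrDl.
exists r%:C; split; first by apply/complex_realP; exists r.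
move=> M rM z /rK zr; rewrite /= normr_cmod (le_trans _ (ltW rM))//.
by rewrite lecR.
Qed.

(* Caratheodory's form of complex differentiability. *)
Definition cdiff (f : C -> C) z :=
  exists2 phi : C -> C, {for z, continuous phi} &
    forall w, f w = f z + phi w * (w - z).

Lemma derivable_cdiff (f : C -> C) z : derivable f z 1 -> cdiff f z.
Proof.
rewrite /derivable => /cvg_ex[l /cvg_cmodP fl].
exists (fun w => if w == z then l else (w - z)^-1 * (f w - f z)).
  apply/continuous_cmodP => e e0.
  have /nbhs_cmodP[d d0 dP] := fl _ e0.
  exists d => // w wz; cbv beta; rewrite eqxx; case: ifPn => [_|wNz].
    by rewrite subrr cmod0.
  have := dP (w - z); rewrite subr0 => /(_ wz).
  rewrite subr_eq0 => /(_ wNz).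
  by rewrite /= /GRing.scale /= mulr1 subrK.
move=> w; case: eqP => [->|/eqP wz]; first by rewrite subrr mulr0 addr0.
by field; rewrite subr_eq0.
Qed.

Let contD (f g : C -> C) z : {for z, continuous f} -> {for z, continuous g} ->
  {for z, continuous (fun w => f w + g w)}.
Proof. exact: (@continuousD R[i] C C f g z). Qed.

Let contM (f g : C -> C) z : {for z, continuous f} -> {for z, continuous g} ->
  {for z, continuous (fun w => f w * g w)}.
Proof. exact: (@continuousM R[i] C f g z). Qed.

Let cont_cst (a : C) z : {for z, continuous (fun=> a)}.
Proof. exact: cst_continuous. Qed.

Lemma cdiff_continuous (f : C -> C) z : cdiff f z -> {for z, continuous f}.
Proof.
move=> [phi phiz fE].
rewrite (_ : f = fun w => f z + phi w * (w - z)); last exact/funext.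
apply: contD; first exact: cont_cst.
apply: contM; first exact: phiz.
by apply: contD; [move=> P|exact: cont_cst].
Qed.

Lemma cdiff_cst (a : C) z : cdiff (fun=> a) z.
Proof. by exists (fun=> 0) => [|w]; [exact: cont_cst|rewrite mul0r addr0]. Qed.

Lemma cdiff_id z : cdiff id z.
Proof. by exists (fun=> 1) => [|w]; [exact: cont_cst|rewrite mul1r subrKC]. Qed.

Lemma cdiffD (f g : C -> C) z :
  cdiff f z -> cdiff g z -> cdiff (fun w => f w + g w) z.
Proof.
move=> [p pz fE] [q qz gE]; exists (fun w => p w + q w).
  exact: (contD pz qz).
by move=> w; rewrite fE gE; ring.
Qed.

Lemma cdiffM (f g : C -> C) z :
  cdiff f z -> cdiff g z -> cdiff (fun w => f w * g w) z.
Proof.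
move=> cf cg; have gz := cdiff_continuous cg.
move: cf cg => [p pz fE] [q qz gE].
exists (fun w => p w * g w + f z * q w).
  apply: contD; apply: contM; [exact: pz|exact: gz|exact: cont_cst|exact: qz].
by move=> w; rewrite (fE w) (gE w); ring.
Qed.

Lemma cdiffX (f : C -> C) z n : cdiff f z -> cdiff (fun w => f w ^+ n) z.
Proof.
move=> cf; elim: n => [|n IH]; first exact: cdiff_cst.
by under eq_fun do rewrite exprS; exact: cdiffM.
Qed.

(** The factorisation in [cdiff] is demanded for all [w], so the slope is taken to be the difference
    quotient of [g], which equals [p] near [z]. *)
Lemma cdiff_near (f g : C -> C) z (e : R) : 0 < e ->
  (forall w, cmod (w - z) < e -> f w = g w) -> cdiff f z -> cdiff g z.
Proof.
move=> e0 fg [p pz fE].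
exists (fun w => if w == z then p z else (g w - g z) / (w - z)).
  apply/continuous_cmodP => e1 e10.
  have [d d0 dP] := (continuous_cmodP _ _).1 pz e1 e10.
  exists (Num.min d e); first by rewrite lt_min d0.
  move=> w; rewrite lt_min => /andP[wd we]; cbv beta; rewrite eqxx.
  case: eqP => [_|/eqP wz]; first by rewrite subrr cmod0.
  have -> : (g w - g z) / (w - z) = p w; last exact: dP.
  rewrite -!fg ?subrr ?cmod0// fE; field.
  by rewrite subr_eq0.
move=> w; case: eqP => [->|/eqP wz]; first by rewrite subrr mulr0 addr0.
by field; rewrite subr_eq0.
Qed.

Lemma cdiffV (f : C -> C) z : f z != 0 -> cdiff f z -> cdiff (fun w => (f w)^-1) z.
Proof.
move=> fz0 cf; have fz := cdiff_continuous cf.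
move: cf => [p pz fE].
have [e e0 eP] : exists2 e : R, 0 < e & forall w, cmod (w - z) < e -> f w != 0.
  have := (continuous_cmodP _ _).1 fz (cmod (f z)).
  rewrite cmod_gt0 => /(_ fz0)[e e0 eP]; exists e => // w /eP.
  by apply: contraTneq => ->; rewrite sub0r cmodN ltxx.
pose q w := - p w * ((f w)^-1 * (f z)^-1).
(* Where [f] vanishes, the convention that the inverse of 0 is 0 breaks the factorisation with slope
   [q]. The function is corrected there, which changes nothing within [e] of [z]. *)
apply: (@cdiff_near (fun w => if f w == 0 then (f z)^-1 + q w * (w - z) else (f w)^-1)
  _ _ e e0).
  by move=> w /eP /negbTE ->.
exists q.
  apply: contM; first exact: (@continuousN R[i] C C p z).
  by apply: contM; [exact: (@continuousV R[i] C f z fz0 fz)|exact: cont_cst].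
move=> w; rewrite (negbTE fz0); case: eqP => // /eqP fw0.
have pE : p w * (w - z) = f w - f z by rewrite fE addrAC subrr add0r.
have -> : q w * (w - z) = - (p w * (w - z)) * ((f w)^-1 * (f z)^-1).
  by rewrite /q; ring.
by rewrite pE; field; rewrite fz0.
Qed.

Lemma cdiff_comp (f g : C -> C) z :
  cdiff f z -> cdiff g (f z) -> cdiff (g \o f) z.
Proof.
move=> cf; have fz := cdiff_continuous cf.
move: cf => [p pz fE] [q qz gE].
exists (fun w => q (f w) * p w).
  apply: contM; last exact: pz.
  exact: (@continuous_comp C C C f q z fz qz).
by move=> w /=; rewrite gE -mulrA; congr (_ + _ * _); rewrite (fE w); ring.
Qed.

End ComplexPlane.

Arguments ci {R}.

(** * Goursat's theorem for Riemann sums, and the bound at the centre of a square *)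

Section Goursat.
Variable R : realType.
Local Notation C := (Cplx R).
Implicit Types (z w c p v : C) (x y e r t : R) (g : C -> C) (N : nat).

Local Notation i := (@ci R).

(** Bottom edge minus top edge, then right edge minus left edge; the factor [i] is the direction of
    the vertical edges relative to [v]. As [v] is any complex number, squares may be tilted. *)
Definition boundary_term g p v t : C :=
  g (p + v * t%:C) - g (p + v * t%:C + i * v) +
  i * (g (p + v + i * v * t%:C) - g (p + i * v * t%:C)).

(* A Riemann sum for the integral of [g] along the boundary of the square with
   vertices p, p + v, p + v + i v, p + i v. *)
Definition boundary_sum g p v N : C :=
  v / N%:R * \sum_(k < N) boundary_term g p v (k%:R / N%:R).

Definition on_boundary p v z := exists2 t : R, 0 <= t <= 1 &
  [\/ z = p + v * t%:C, z = p + v * t%:C + i * v,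
      z = p + v + i * v * t%:C | z = p + i * v * t%:C].

Definition in_square p v z := exists t : R * R,
  [/\ 0 <= t.1 <= 1, 0 <= t.2 <= 1 & z = p + v * (t.1%:C + i * t.2%:C)].

Lemma boundary_sumB g1 g2 p v N :
  boundary_sum (fun z => g1 z - g2 z) p v N =
  boundary_sum g1 p v N - boundary_sum g2 p v N.
Proof.
rewrite /boundary_sum -mulrBr -sumrB; congr (_ * _); apply: eq_bigr => k _.
by rewrite /boundary_term; ring.
Qed.

Lemma boundary_sumZ (a : C) g p v N :
  boundary_sum (fun z => a * g z) p v N = a * boundary_sum g p v N.
Proof.
rewrite /boundary_sum mulrCA; congr (_ * _); rewrite mulr_sumr; apply: eq_bigr => k _.
by rewrite /boundary_term; ring.
Qed.

(** Opposite sample points differ by [i * v] or by [v], so the two differences cancel in each term.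
    The sum is exactly zero for every [N], without a limit. *)
Lemma boundary_sum_affine (a b : C) p v N : boundary_sum (fun z => a + b * z) p v N = 0.
Proof.
by rewrite /boundary_sum big1 ?mulr0// => k _; rewrite /boundary_term; ring.
Qed.

Lemma boundary_sum_le g p v N (B : R) : (0 < N)%N ->
  (forall z, on_boundary p v z -> cmod (g z) <= B) ->
  cmod (boundary_sum g p v N) <= 4 * B * cmod v.
Proof.
move=> N0 gB.
have N0' : 0 < N%:R :> R by rewrite ltr0n.
have cN : cmod (N%:R : C) = N%:R.
  exact: cmod_nat.
have step (k : 'I_N) : cmod (boundary_term g p v (k%:R / N%:R)) <= 4 * B.
  have t01 : 0 <= (k%:R / N%:R : R) <= 1.
    by rewrite divr_ge0//= ler_pdivrMr// mul1r ler_nat ltnW.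
  rewrite /boundary_term; set t := (k%:R / N%:R)%:C.
  apply: (le_trans (cmodD _ _)); rewrite cmodM cmod_ci mul1r.
  have B1 : cmod (g (p + v * t)) <= B.
    by apply: gB; exists (k%:R / N%:R) => //; constructor 1.
  have B2 : cmod (g (p + v * t + i * v)) <= B.
    by apply: gB; exists (k%:R / N%:R) => //; constructor 2.
  have B3 : cmod (g (p + v + i * v * t)) <= B.
    by apply: gB; exists (k%:R / N%:R) => //; constructor 3.
  have B4 : cmod (g (p + i * v * t)) <= B.
    by apply: gB; exists (k%:R / N%:R) => //; constructor 4.
  have := cmodD (g (p + v * t)) (- g (p + v * t + i * v)).
  have := cmodD (g (p + v + i * v * t)) (- g (p + i * v * t)).
  rewrite !cmodN; lra.
rewrite /boundary_sum !cmodM cmodV cN.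
have /le_trans : cmod (\sum_(k < N) boundary_term g p v (k%:R / N%:R)) <= N%:R * (4 * B).
  apply: (le_trans (cmod_sum _ (fun k => boundary_term g p v (k%:R / N%:R)))).
  apply: (@le_trans _ _ (\sum_(k < N) (4 * B))); first by apply: ler_sum => k _.
  by rewrite sumr_const card_ord -[leLHS]mulr_natl.
move/(_ _ (lexx _)) => H.
rewrite [leRHS](_ : _ = cmod v / N%:R * (N%:R * (4 * B))).
  by rewrite ler_wpM2l// divr_ge0// cmod_ge0.
by field; rewrite gt_eqF.
Qed.

(** Inner edges are traversed twice, in opposite directions. Cutting into three, not two, keeps the
    centre of the square away from the cuts, as [goursat_punctured] requires. *)
Lemma boundary_sum_trisect g p v N : (0 < N)%N ->
  boundary_sum g p (3%:R * v) (3 * N) =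
  \sum_(a < 3) \sum_(b < 3) boundary_sum g (p + v * (a%:R + i * b%:R)) v N.
Proof.
move=> N0.
have N0' : (N%:R : R) != 0 by rewrite pnatr_eq0 -lt0n.
have N0C : (N%:R : C) != 0 by rewrite pnatr_eq0 -lt0n.
pose tt (k : nat) : C := (k%:R / N%:R : R)%:C.
(* [h1] and [h2] are the values at the sample points of the horizontal and vertical edges of the
   grid. *)
pose h1 a b k := g (p + v * (a%:R + tt k) + i * v * b%:R).
pose h2 a b k := g (p + v * a%:R + i * v * (b%:R + tt k)).
have R1 a b : boundary_sum g (p + v * (a%:R + i * b%:R)) v N =
    \sum_(k < N) (v / N%:R * (h1 a b k - h1 a b.+1 k + i * (h2 a.+1 b k - h2 a b k))).
  rewrite /boundary_sum mulr_sumr; apply: eq_bigr => k _; congr (_ * _).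
  rewrite /boundary_term /h1 /h2 -/(tt k) -![_.+1%:R]natr1.
  by congr (g _ - g _ + i * (g _ - g _)); ring.
have L1 : boundary_sum g p (3%:R * v) (3 * N) =
   \sum_(k < N) (v / N%:R * (
     (h1 0%N 0%N k - h1 0%N 3%N k + i * (h2 3%N 0%N k - h2 0%N 0%N k)) +
     (h1 1%N 0%N k - h1 1%N 3%N k + i * (h2 3%N 1%N k - h2 0%N 1%N k)) +
     (h1 2%N 0%N k - h1 2%N 3%N k + i * (h2 3%N 2%N k - h2 0%N 2%N k)))).
  rewrite /boundary_sum.
  have -> : 3%:R * v / (3 * N)%:R = v / N%:R.
    by rewrite natrM; field; rewrite N0C.
  have -> : (3 * N = N + N + N)%N by rewrite !mulSn mul0n addn0 addnA.
  rewrite !big_split_ord /= -big_split /= -big_split /= mulr_sumr; apply: eq_bigr => k _.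
  (* Sample point [a * N + k] of the long edge is sample point [k] of its piece number [a]. *)
  have E (a : nat) : 3%:R * v * ((a * N + k)%:R / (N + N + N)%:R : R)%:C =
      v * (a%:R + tt k).
    rewrite /tt !natrD natrM.
    have -> : (a%:R * N%:R + k%:R) / (N%:R + N%:R + N%:R) =
        (a%:R + k%:R / N%:R) / 3%:R :> R.
      by field; rewrite N0' -!natrD pnatr_eq0 -lt0n !addn_gt0 N0.
    rewrite !realcE; field.
  exact: N0C.
  have E0 := E 0%N; have E1 := E 1%N; have E2 := E 2%N.
  rewrite mul0n add0n in E0; rewrite mul1n in E1; rewrite mul2n -addnn in E2.
  rewrite /boundary_term /h1 /h2; congr (_ * (_ + _ + _)).
  - by congr (g _ - g _ + i * (g _ - g _)); rewrite -?(mulrA i) E0; ring.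
  - by congr (g _ - g _ + i * (g _ - g _)); rewrite -?(mulrA i) E1; ring.
  - by congr (g _ - g _ + i * (g _ - g _)); rewrite -?(mulrA i) E2; ring.
rewrite L1; under [RHS]eq_bigr do under eq_bigr do rewrite R1.
under [RHS]eq_bigr do rewrite exchange_big /=.
rewrite [RHS]exchange_big /=; apply: eq_bigr => k _.
by rewrite !big_ord_recr !big_ord0 /=; ring.
Qed.

Lemma on_boundary_in_square p v z : on_boundary p v z -> in_square p v z.
Proof.
move=> [t t01 zE].
have L : 0 <= (0 : R) <= 1 by rewrite lexx ler01.
have U : 0 <= (1 : R) <= 1 by rewrite lexx ler01.
case: zE => ->; [exists (t, 0)|exists (t, 1)|exists (1, t)|exists (0, t)];
  by split => //=; ring.
Qed.

Lemma in_square_cmod p v z : in_square p v z -> cmod (z - p) <= 2 * cmod v.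
Proof.
move=> [[a b] [/= /andP[a0 a1] /andP[b0 b1] ->]].
rewrite addrAC subrr add0r cmodM mulrC ler_wpM2r ?cmod_ge0//.
apply: (le_trans (cmodD _ _)).
by rewrite cmodM cmod_ci !cmod_real !ger0_norm//; lra.
Qed.

(** Subtracting the tangent map [l] at [z] does not change the sum. On the boundary the remainder is
    at most [e / 16] times the distance to [z], which is at most [4 * cmod v]; four edges then give
    the bound. *)
Lemma boundary_sum_local g z (e : R) : cdiff g z -> 0 < e -> exists2 d : R, 0 < d &
  forall p v N, (0 < N)%N -> in_square p v z -> cmod v < d ->
    cmod (boundary_sum g p v N) <= e * cmod v ^+ 2.
Proof.
move=> [phi phiz gE] e0.
have e16 : 0 < e / 16 by lra.
have [d d0 dP] := (continuous_cmodP _ _).1 phiz _ e16.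
exists (d / 4); first by lra.
move=> p v N N0 sqz vd.
pose l w := (g z - phi z * z) + phi z * w.
have -> : boundary_sum g p v N = boundary_sum (fun w => g w - l w) p v N.
  by rewrite boundary_sumB boundary_sum_affine subr0.
have /boundary_sum_le : forall w, on_boundary p v w -> cmod (g w - l w) <= e / 4 * cmod v.
  move=> w /on_boundary_in_square sqw.
  have wz : cmod (w - z) <= 4 * cmod v.
    have := cmod_triangle p w z; have := in_square_cmod sqz; have := in_square_cmod sqw.
    by rewrite (cmod_distC p z); lra.
  rewrite (_ : g w - l w = (phi w - phi z) * (w - z)); last by rewrite /l gE; ring.
  have /dP/ltW : cmod (w - z) < d by lra.
  have := cmod_ge0 (w - z); have := cmod_ge0 (phi w - phi z).
  by rewrite cmodM; nra.
move/(_ _ N0) => H; apply: (le_trans H).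
by rewrite expr2; have := cmod_ge0 v; nra.
Qed.

Lemma cmod_sum3 (F : 'I_3 -> C) : cmod (\sum_a F a) <= \sum_a cmod (F a).
Proof.
rewrite !big_ord_recr !big_ord0 /= !add0r.
by apply: (le_trans (cmodD _ _)); rewrite lerD2r cmodD.
Qed.

(* The threshold is on the divisibility of the number of sample points, so
   that finitely many thresholds can be met simultaneously. *)
Definition small_sums g p v e := exists2 N, (0 < N)%N &
  forall k, (0 < k)%N -> cmod (boundary_sum g p v (N * k)) <= e.

(** The product of the nine thresholds is a common multiple of them, hence serves all nine
    squares. *)
Lemma small_sums_trisect g p v (e : 'I_3 -> 'I_3 -> R) :
  (forall a b : 'I_3, small_sums g (p + v * (a%:R + i * b%:R)) v (e a b)) ->
  small_sums g p (3%:R * v) (\sum_a \sum_b e a b).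
Proof.
move=> H.
have {H}/choice[M MP] : forall ab : 'I_3 * 'I_3, exists N, (0 < N)%N /\
  forall k, (0 < k)%N ->
    cmod (boundary_sum g (p + v * (ab.1%:R + i * ab.2%:R)) v (N * k)) <= e ab.1 ab.2.
  by move=> [a b]; have [N N0 NP] := H a b; exists N.
pose P := (\prod_ab M ab)%N.
have P0 : (0 < P)%N by apply: prodn_gt0 => ab; case: (MP ab).
have dvdP ab : (M ab %| P)%N by rewrite /P (bigD1 ab)//= dvdn_mulr.
exists (3 * P)%N; first by rewrite muln_gt0.
move=> k k0; rewrite -mulnA boundary_sum_trisect ?muln_gt0 ?P0//.
have step (a b : 'I_3) :
    cmod (boundary_sum g (p + v * (a%:R + i * b%:R)) v (P * k)) <= e a b.
  have /dvdnP[q PE] := dvdP (a, b).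
  have [M0 MM] := MP (a, b).
  have : (0 < q)%N by move: P0; rewrite PE muln_gt0 => /andP[].
  rewrite PE (mulnC q) -mulnA => q0; apply: MM.
  by rewrite muln_gt0 q0.
apply: (le_trans (cmod_sum3 _)); apply: ler_sum => a _.
by apply: (le_trans (cmod_sum3 _)); apply: ler_sum.
Qed.

Lemma nested_intervals (l u : nat -> R) :
  (forall n, l n <= l n.+1) -> (forall n, u n.+1 <= u n) ->
  (forall n, l n <= u n) -> exists x, forall n, l n <= x <= u n.
Proof.
move=> l_nd u_ni lu.
have lm m n : (m <= n)%N -> l m <= l n.
  by move=> mn; apply: (@homo_leq _ l <=%O le_refl le_trans l_nd).
have um m n : (m <= n)%N -> u n <= u m.
  move=> mn; rewrite -lerN2.
  apply: (@homo_leq _ (fun n => - u n) <=%O le_refl le_trans) mn => j.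
  by rewrite lerN2.
have lub m n : l m <= u n.
  apply: (le_trans (lm _ _ (leq_maxl m n))); apply: (le_trans (lu _)).
  exact: um (leq_maxr m n).
have hs : has_sup (range l).
  by split; [exists (l 0%N), 0%N|exists (u 0%N) => _ [m _ <-]].
exists (sup (range l)) => n; apply/andP; split.
  by apply: sup_upper_bound => //; exists n.
by apply: ge_sup; [exact: hs.1|move=> _ [m _ <-]].
Qed.

Lemma scale3_small (x d : R) : 0 < d -> exists n, x / 3 ^+ n < d.
Proof.
move=> d0; pose n := (Num.truncn (x / d)).+1; exists n.
have xn : x / d < n%:R.
  by rewrite /n; apply: truncnS_gt.
have n3 m : (m%:R : R) <= 3 ^+ m.
  elim: m => [|m IH]; first by rewrite expr0 ler01.
  have : 1 <= 3 ^+ m :> R by rewrite exprn_ege1// ler1n.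
  by rewrite exprS -[m.+1%:R]natr1; lra.
have p3 : 0 < (3 : R) ^+ n by rewrite exprn_gt0.
rewrite ltr_pdivrMr// mulrC -ltr_pdivrMr//.
exact: lt_le_trans (n3 n).
Qed.

(** With a tolerance proportional to the area, a bad square has a bad square among its nine parts.
    Nested bad squares shrink to a point [z], where [boundary_sum_local] makes small squares
    good. *)
Lemma goursat_square g p v e : 0 < e -> (forall z, in_square p v z -> cdiff g z) ->
  small_sums g p v e.
Proof.
(* The added 1 keeps the denominator positive when [v] is 0. *)
move=> e0 gd; pose e1 := e / (cmod v ^+ 2 + 1).
have v1 : 0 < cmod v ^+ 2 + 1 by rewrite ltr_wpDl// sqr_ge0.
have e10 : 0 < e1 by rewrite divr_gt0.
pose s n : R := (3 ^+ n)^-1.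
have s0 n : 0 < s n by rewrite invr_gt0 exprn_gt0.
have s3 n : s n = 3 * s n.+1.
  by rewrite /s exprS invfM mulrA divff ?mul1r.
pose corner (x : R * R) := p + v * (x.1%:C + i * x.2%:C).
pose good n (x : R * R) :=
  small_sums g (corner x) (v * (s n)%:C) (e1 * (cmod v * s n) ^+ 2).
have good_sub n (x : R * R) :
  (forall y : R * R, x.1 <= y.1 -> y.1 + s n.+1 <= x.1 + s n ->
    x.2 <= y.2 -> y.2 + s n.+1 <= x.2 + s n -> good n.+1 y) -> good n x.
  move=> H.
  have : forall a b : 'I_3, good n.+1 (x.1 + a%:R * s n.+1, x.2 + b%:R * s n.+1).
    have le2 (a : 'I_3) : 0 <= (a%:R : R) <= 2.
      by rewrite ler0n /= ler_nat -ltnS.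
    move=> a b; have := le2 a; have := le2 b => /andP[b0 b2] /andP[a0 a2].
    by apply: H; rewrite /= ?(s3 n); have := s0 n.+1; nra.
  rewrite /good => H1.
  have E : v * (s n)%:C = 3%:R * (v * (s n.+1)%:C).
    by rewrite s3 !realcE; ring.
  rewrite E.
  have -> : e1 * (cmod v * s n) ^+ 2 =
      \sum_(a < 3) \sum_(b < 3) e1 * (cmod v * s n.+1) ^+ 2.
    by rewrite !sumr_const !card_ord (s3 n); ring.
  apply: small_sums_trisect => a b.
  rewrite [X in small_sums g X](_ : _ =
    corner (x.1 + a%:R * s n.+1, x.2 + b%:R * s n.+1)).
    exact: H1.
  by rewrite /corner /= !realcE; ring.
apply: contrapT => bad0.
have bad00 : ~ good 0%N (0, 0).
  move=> [N N0 NP]; apply: bad0; exists N => // k k0.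
  have := NP k k0.
  rewrite /corner /s expr0 invr1 /= mulr1 mulr0 addr0 mulr0 addr0 mulr1 => H.
  apply: (le_trans H).
  by rewrite /e1 mulrAC ler_pdivrMr//; nra.
(* Badness is a premise inside the existential, so that [choice] yields a successor function on all
   squares. *)
have {good_sub}step : forall nx : nat * (R * R), exists y : R * R,
    ~ good nx.1 nx.2 ->
    [/\ ~ good nx.1.+1 y, nx.2.1 <= y.1 /\ y.1 + s nx.1.+1 <= nx.2.1 + s nx.1 &
     nx.2.2 <= y.2 /\ y.2 + s nx.1.+1 <= nx.2.2 + s nx.1].
  move=> [n x]; apply: contrapT => H; have := H; apply.
  exists x => /= bad; exfalso; apply: bad; apply: good_sub => y y1 y2 y3 y4.
  by apply: contrapT => bady; apply: H; exists y => _; split.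
have [nxt nxtP] := choice step.
pose fix x n := if n is n'.+1 then nxt (n', x n') else (0, 0).
have xbad n : ~ good n (x n).
  by elim: n => [//|n IH]; have [] := nxtP (n, x n) IH.
have [|||a aP] := @nested_intervals (fun n => (x n).1) (fun n => (x n).1 + s n).
- by move=> n; have [_ []] := nxtP (n, x n) (@xbad n).
- by move=> n; have [_ []] := nxtP (n, x n) (@xbad n).
- by move=> n; rewrite lerDl ltW.
have [|||b bP] := @nested_intervals (fun n => (x n).2) (fun n => (x n).2 + s n).
- by move=> n; have [_ _ []] := nxtP (n, x n) (@xbad n).
- by move=> n; have [_ _ []] := nxtP (n, x n) (@xbad n).
- by move=> n; rewrite lerDl ltW.
pose z := corner (a, b).
have zsq n : in_square (corner (x n)) (v * (s n)%:C) z.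
  exists ((a - (x n).1) / s n, (b - (x n).2) / s n).
  have /andP[a1 a2] := aP n; have /andP[b1 b2] := bP n.
  have sn := s0 n; split => /=.
  - by rewrite divr_ge0 ?subr_ge0 ?(ltW sn)//= ler_pdivrMr// mul1r lerBlDl.
  - by rewrite divr_ge0 ?subr_ge0 ?(ltW sn)//= ler_pdivrMr// mul1r lerBlDl.
  - rewrite /z /corner /=; move: (s n) sn => t t0; rewrite !realcE; field.
    by rewrite rc_eq0 gt_eqF.
have gz : cdiff g z.
  apply: gd; have := zsq 0%N.
  rewrite /corner /s expr0 invr1 /= mulr1; rewrite mulr0 addr0.
  by rewrite mulr0 addr0.
have [d d0 dP] := boundary_sum_local gz e10.
have [n nd] := @scale3_small (cmod v) _ d0.
(* The local estimate holds for every number of sample points, so the threshold is 1. *)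
apply: (@xbad n); exists 1%N => // k k0; rewrite mul1n.
have sE : cmod (v * (s n)%:C) = cmod v * s n.
  by rewrite cmodM cmod_real ger0_norm// ltW.
by rewrite -sE; apply: dP => //; rewrite sE.
Qed.


(** The square with this corner and side [v] has centre [c]. *)
Definition corner_of c v := c - v * ((1 + i) / 2%:R).

(* Only the central ninth of the square contains the singularity; after n
   trisections it contributes at most K times its perimeter. *)
Lemma goursat_punctured g c v (K d e : R) : 0 < d -> 0 < e ->
  (forall z, z != c -> cdiff g z) -> (forall z, cmod (z - c) < d -> cmod (g z) <= K) ->
  v != 0 -> small_sums g (corner_of c v) v e.
Proof.
move=> d0 e0 gd gK v0.
(* [n] is the number of trisections to perform. At [n = 0] the condition puts the square inside the
   disc where [K] bounds [g], and makes the perimeter times [K] smaller than [e]. *)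
suff H n : forall v e, v != 0 -> 0 < e ->
    2 * cmod v / 3 ^+ n < Num.min d (e / (`|K| * 2 + 1)) ->
    small_sums g (corner_of c v) v e.
  have m0 : 0 < Num.min d (e / (`|K| * 2 + 1)).
    by rewrite lt_min d0 divr_gt0// ltr_wpDl// mulr_ge0.
  by have [n nd] := @scale3_small (2 * cmod v) _ m0; exact: (H n).
elim: n => [|n IH] {}v {}e {}v0 {}e0.
  rewrite expr0 divr1 lt_min => /andP[vd ve].
  exists 1%N => // k k0; rewrite mul1n.
  have : forall z, on_boundary (corner_of c v) v z -> cmod (g z) <= `|K|.
    move=> z /on_boundary_in_square[[a b] [/= /andP[a0 a1] /andP[b0 b1] ->]].
    apply: le_trans (ler_norm K); apply: gK; apply: le_lt_trans vd.
    rewrite (_ : _ - c = v * ((a - 1 / 2)%:C + i * (b - 1 / 2)%:C)); last first.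
      by rewrite /corner_of !realcE; field.
    rewrite cmodM mulrC ler_wpM2r ?cmod_ge0//; apply: (le_trans (cmodD _ _)).
    rewrite cmodM cmod_ci !cmod_real.
    have : `|a - 1 / 2| <= 1 by rewrite ler_norml; lra.
    have : `|b - 1 / 2| <= 1 by rewrite ler_norml; lra.
    by lra.
  move=> /(boundary_sum_le k0)/le_trans; apply.
  move: ve; rewrite ltr_pdivlMr ?ltr_wpDl// ?mulr_ge0// => ve.
  have := cmod_ge0 v; have := normr_ge0 K; nra.
move=> ve.
have w0 : v / 3%:R != 0 by rewrite mulf_neq0// invr_eq0 pnatr_eq0.
have cw : cmod (v / 3%:R) = cmod v / 3 by rewrite cmodM cmodV cmod_nat.
have K0 : 0 < `|K| * 2 + 1 by rewrite ltr_wpDl// mulr_ge0.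
(* A midpoint [e'] still meets the smallness condition for the central square and leaves a positive
   tolerance to share among the eight others. *)
have [e' /andP[e'0 e'e] vE] : exists2 e' : R, 0 < e' < e &
    2 * cmod (v / 3%:R) / 3 ^+ n < Num.min d (e' / (`|K| * 2 + 1)).
  have -> : 2 * cmod (v / 3%:R) / 3 ^+ n = 2 * cmod v / 3 ^+ n.+1.
    by rewrite cw exprS; field; rewrite expf_neq0.
  move: ve; set X := 2 * cmod v / _; rewrite lt_min ltr_pdivlMr// => /andP[Xd Xe].
  have X0 : 0 <= X by rewrite divr_ge0 ?mulr_ge0 ?cmod_ge0// exprn_ge0.
  exists ((X * (`|K| * 2 + 1) + e) / 2).
    have : 0 <= X * (`|K| * 2 + 1) by rewrite mulr_ge0// ltW.
    by move=> ?; apply/andP; split; lra.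
  by rewrite lt_min Xd ltr_pdivlMr//=; lra.
have IHv := IH _ _ w0 e'0 vE.
pose ee (a b : 'I_3) :=
  if (a == 1%N :> nat) && (b == 1%N :> nat) then e' else (e - e') / 8.
have -> : v = 3%:R * (v / 3%:R) by field.
have -> : e = \sum_a \sum_b ee a b.
  by rewrite /ee !big_ord_recr !big_ord0 /=; field.
apply: small_sums_trisect => a b; rewrite /ee.
case: ifPn => [/andP[/eqP -> /eqP ->]|ab].
  rewrite [X in small_sums g X](_ : _ = corner_of c (v / 3%:R)) //.
  by rewrite /corner_of; field.
apply: goursat_square; first by rewrite divr_gt0// subr_gt0.
move=> z [[x y] [/= x01 y01 zE]]; apply: gd; apply: contra ab => /eqP zc.
move: zE; rewrite zc => cE.
have {cE} : (v / 3%:R) * ((a%:R + x - 3 / 2)%:C + i * (b%:R + y - 3 / 2)%:C) = 0.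
  have -> : (v / 3%:R) * ((a%:R + x - 3 / 2)%:C + i * (b%:R + y - 3 / 2)%:C) =
    corner_of c (3%:R * (v / 3%:R)) + v / 3%:R * (a%:R + i * b%:R) +
          v / 3%:R * (x%:C + i * y%:C) - c.
    by rewrite /corner_of !realcE; field.
  by rewrite -cE subrr.
move/eqP; rewrite mulf_eq0 (negbTE w0) /= /ci => /eqP; simpc.
case=> xE yE.
(* The centre has both coordinates equal to 3/2 in units of the small side, so only the part with
   indices 1, 1 contains it. *)
have nat1 (m : nat) (t : R) : 0 <= t <= 1 -> m%:R + t - 3 / 2 = 0 -> m == 1%N.
  move=> /andP[t0 t1] mE.
  have m1 : (m%:R : R) < 2%:R by lra.
  have m2 : (0%:R : R) < m%:R by lra.
  by move: m1 m2; rewrite !ltr_nat; case: m {mE} => [|[|[|]]].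
by rewrite (nat1 a x)// (nat1 b y).
Qed.


(** A crude substitute for the value 2 pi i of the integral: each term is [2 i y] with [y >= 2], so
    nothing cancels and the average has modulus at least 4. *)
Lemma boundary_sum_kernel c v N : (0 < N)%N -> v != 0 ->
  4 <= cmod (boundary_sum (fun z => (z - c)^-1) (corner_of c v) v N).
Proof.
move=> N0 v0.
have N0' : 0 < (N%:R : R) by rewrite ltr0n.
pose s (k : nat) : R := k%:R / N%:R - 1 / 2.
pose y k : R := (s k ^+ 2 + 1 / 4)^-1.
have sk (k : 'I_N) : s k ^+ 2 <= 1 / 4.
  have k0 : 0 <= (k%:R / N%:R : R) by rewrite divr_ge0.
  have k1 : (k%:R / N%:R : R) <= 1 by rewrite ler_pdivrMr// mul1r ler_nat ltnW.
  by rewrite /s expr2; nra.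
have y2 (k : 'I_N) : 2 <= y k.
  have := sqr_ge0 (s k); have := sk k => h1 h2.
  by rewrite /y -[leLHS]invrK lef_pV2 ?posrE; lra.
have term (k : 'I_N) :
    v * boundary_term (fun z => (z - c)^-1) (corner_of c v) v (k%:R / N%:R) =
    2%:R * i * (y k)%:C.
  (* Relative to [c] and in units of [v], the bottom, top, right and left sample points are [A],
     [B], [i * A] and [i * B]. *)
  pose A : C := (s k)%:C - i / 2%:R; pose B : C := (s k)%:C + i / 2%:R.
  have AB : A * B = (s k ^+ 2 + 1 / 4)%:C.
    rewrite (_ : A * B = (s k)%:C ^+ 2 - i * i / 4%:R); last by rewrite /A /B; field.
    by rewrite ci_sqr; move: (s k) => t; rewrite !realcE; field.
  have AB0 : A * B != 0.
    rewrite AB rc_eq0 gt_eqF//.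
    by have := sqr_ge0 (s k); lra.
  have [A0 B0] : A != 0 /\ B != 0 by move: AB0; rewrite mulf_eq0 negb_or => /andP[].
  have i0 : i != 0 by rewrite -cmod_eq0 cmod_ci oner_eq0.
  have iV : i^-1 = - i by apply: (mulfI i0); rewrite divff// mulrN ci_sqr opprK.
  rewrite /boundary_term.
  have -> : corner_of c v + v * (k%:R / N%:R)%:C - c = v * A.
    by rewrite /A /s /corner_of !realcE; field; rewrite pnatr_eq0 -lt0n.
  have -> : corner_of c v + v * (k%:R / N%:R)%:C + i * v - c = v * B.
    by rewrite /B /s /corner_of !realcE; field; rewrite pnatr_eq0 -lt0n.
  have -> : corner_of c v + v + i * v * (k%:R / N%:R)%:C - c = v * (i * A).
    rewrite /A mulrBr (mulrA i i) ci_sqr /s /corner_of !realcE; field.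
    by rewrite pnatr_eq0 -lt0n.
  have -> : corner_of c v + i * v * (k%:R / N%:R)%:C - c = v * (i * B).
    rewrite /B mulrDr (mulrA i i) ci_sqr /s /corner_of !realcE; field.
    by rewrite pnatr_eq0 -lt0n.
  rewrite /y rcV -AB.
  have -> : 2%:R * i * (A * B)^-1 = 2%:R * (B - A) * (A * B)^-1.
    by congr (_ * _ * _); rewrite /A /B; field.
  by field; rewrite v0 i0 A0 B0.
rewrite /boundary_sum mulrAC mulr_sumr.
under eq_bigr do rewrite term.
rewrite -mulr_sumr mulrAC mulrC.
rewrite -(rmorph_sum (real_complex R)) /=.
have y0 : 0 <= \sum_(k < N) y k.
  by apply: sumr_ge0 => k _; rewrite (le_trans _ (y2 k)).
have yN : 2 * N%:R <= \sum_(k < N) y k.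
  rewrite mulr_natr -{1}(card_ord N) -sumr_const.
  by apply: ler_sum => k _; exact: y2.
rewrite !cmodM cmodV !cmod_nat cmod_ci cmod_real mulr1 ger0_norm//.
by rewrite mulrA ler_pdivlMr//; lra.
Qed.

(** If [q < x], Bernoulli's inequality makes the powers of [x / q] exceed 2. This removes the
    constant lost in the crude estimates. *)
Lemma le_of_powers_le (x q : R) : 0 <= x -> 0 <= q ->
  (forall n, x ^+ n <= 2 * q ^+ n) -> x <= q.
Proof.
move=> x0 q0 H; rewrite leNgt; apply/negP => qx.
have xgt0 : 0 < x by exact: le_lt_trans qx.
have [q00|qN0] := eqVneq q 0.
  by have := H 1%N; rewrite !expr1 q00 mulr0 leNgt xgt0.
have qgt0 : 0 < q by rewrite lt_def qN0.
pose h := x / q - 1.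
have h0 : 0 < h by rewrite subr_gt0 ltr_pdivlMr// mul1r.
have bern n : 1 + n%:R * h <= (x / q) ^+ n.
  elim: n => [|n IH]; first by rewrite mul0r addr0 expr0.
  rewrite exprS -natr1 (_ : x / q = 1 + h); last by rewrite /h subrKC.
  rewrite (_ : x / q = 1 + h) in IH; last by rewrite /h subrKC.
  have : 0 <= n%:R * h by rewrite mulr_ge0// ltW.
  nra.
pose n := (Num.truncn (1 / h)).+1.
have nh : 1 < n%:R * h by rewrite -ltr_pdivrMr//; exact: truncnS_gt.
have := bern n; rewrite expr_div_n ler_pdivlMr ?exprn_gt0// => H1.
have := H n; have : 0 < q ^+ n by rewrite exprn_gt0.
by nra.
Qed.

(** The quotient [h] is bounded near [c], so its sums are small. They split into [S1], at most
    [8 * q ^+ n], and [g c ^+ n] times a kernel sum of modulus at least 4. *)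
Lemma cmod_centre_le g c v (q : R) : v != 0 -> (forall z, cdiff g z) ->
  (forall z, on_boundary (corner_of c v) v z -> cmod (g z) <= q) -> cmod (g c) <= q.
Proof.
move=> v0 gd gq.
have cv0 : 0 < cmod v by rewrite cmod_gt0.
have q0 : 0 <= q.
  apply: le_trans (gq _ _); first exact: cmod_ge0.
  by exists 0; [rewrite lexx ler01|constructor 1].
apply: le_of_powers_le => //; first exact: cmod_ge0.
move=> n; apply/ler_addgt0Pr => e e0.
pose k z : C := (z - c)^-1.
pose h z := (g z ^+ n) * k z - g c ^+ n * k z.
have kd z : z != c -> cdiff k z.
  move=> zc; apply: cdiffV; first by rewrite subr_eq0.
  exact: cdiffD (cdiff_id _) (cdiff_cst _ _).
have gn z : cdiff (fun z => g z ^+ n) z by exact: cdiffX.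
have hd z : z != c -> cdiff h z.
  move=> /kd zc; rewrite /h.
  under eq_fun do rewrite -mulNr.
  by apply: cdiffD; apply: cdiffM => //; exact: cdiff_cst.
have [d d0 [K hK]] : exists2 d : R, 0 < d &
    exists K : R, forall z, cmod (z - c) < d -> cmod (h z) <= K.
  have [phi phic gE] := gn c.
  have [d d0 dP] := (continuous_cmodP _ _).1 phic 1 ltr01.
  exists d => //; exists (cmod (phi c) + 1) => z /dP zd.
  have [->|zc] := eqVneq z c.
    by rewrite /h subrr cmod0 addr_ge0// cmod_ge0.
  have -> : h z = phi z.
    by rewrite /h /k gE; field; rewrite subr_eq0.
  by have := cmodD (phi z - phi c) (phi c); rewrite subrK; lra.
have [N N0 /(_ 1%N isT)] := goursat_punctured d0 e0 hd hK v0.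
rewrite muln1 boundary_sumB boundary_sumZ.
set S1 := boundary_sum _ _ _ _; set S2 := boundary_sum _ _ _ _ => SS.
have S1q : cmod S1 <= 8 * q ^+ n.
  have /(boundary_sum_le N0)/le_trans : forall z, on_boundary (corner_of c v) v z ->
      cmod (g z ^+ n * k z) <= 2 * q ^+ n / cmod v.
    move=> z zb; rewrite cmodM cmodX cmodV.
    (* On each edge one of the two coordinates about the centre is 1/2 in absolute value. *)
    have : cmod v / 2 <= cmod (z - c).
      have half (a b : R) : 1 / 2 <= `|a| \/ 1 / 2 <= `|b| ->
          cmod v / 2 <= cmod (v * (a%:C + i * b%:C)).
        rewrite cmodM => ab; rewrite ler_wpM2l ?cmod_ge0// -[leLHS]div1r.
        have := ReIm_le_cmod (a%:C + i * b%:C : C); rewrite /ci; simpc => /=.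
        by case: ab => ? [? ?]; lra.
      have h1 : 1 / 2 <= `|1 / 2 : R| by rewrite ger0_norm//; lra.
      have h2 : 1 / 2 <= `|- (1 / 2) : R| by rewrite normrN.
      case: zb => t _ [] ->; rewrite /corner_of.
      + rewrite (_ : _ - c = v * ((t - 1 / 2)%:C + i * (- (1 / 2))%:C)).
          by apply: half; right.
        by rewrite !realcE; field.
      + rewrite (_ : _ - c = v * ((t - 1 / 2)%:C + i * (1 / 2)%:C)).
          by apply: half; right.
        by rewrite !realcE; field.
      + rewrite (_ : _ - c = v * ((1 / 2)%:C + i * (t - 1 / 2)%:C)).
          by apply: half; left.
        by rewrite !realcE; field.
      + rewrite (_ : _ - c = v * ((- (1 / 2))%:C + i * (t - 1 / 2)%:C)).
          by apply: half; left.
        by rewrite !realcE; field.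
    move=> vz; rewrite mulrAC [leRHS]mulrC; apply: ler_pM.
    - by rewrite exprn_ge0// cmod_ge0.
    - by rewrite invr_ge0 cmod_ge0.
    - by apply: lerXn2r; rewrite ?nnegrE ?cmod_ge0// gq.
    - rewrite -[leRHS]invrK lef_pV2 ?posrE ?invf_div//.
        by apply: lt_le_trans vz; rewrite divr_gt0.
      by rewrite divr_gt0.
  apply; rewrite le_eqVlt; apply/orP; left; apply/eqP; field.
  by rewrite gt_eqF.
have S2q : 4 * cmod (g c) ^+ n <= cmod (g c ^+ n * S2).
  by rewrite cmodM cmodX mulrC ler_wpM2l ?exprn_ge0 ?cmod_ge0// boundary_sum_kernel.
have := cmodD (S1 - g c ^+ n * S2) (- S1).
rewrite addrAC subrr add0r !cmodN; lra.
Qed.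

End Goursat.

(** * Maximum principle, identity principle and strict growth of the maximum modulus *)

Section MaximumPrinciple.
Variable R : realType.
Local Notation C := (Cplx R).
Implicit Types (z w c p v : C) (x y e r t : R) (f g : C -> C) (N : nat).

Local Notation i := (@ci R).

Lemma continuous_max (K : set C) (u : C -> R) r :
  closed K -> (forall z, K z -> cmod z <= r) -> K !=set0 -> continuous u ->
  exists2 z, K z & forall w, K w -> u w <= u z.
Proof.
move=> Kc Kr K0 uc.
have [||z zK zmax] := @compact_EVT_max C R u K K0.
- exact: bounded_closed_compactC Kc Kr.
- exact: continuous_subspaceT.
exists z; first by rewrite inE in zK.
by move=> w Kw; apply: zmax; rewrite inE.
Qed.

Lemma continuous_min (K : set C) (u : C -> R) r :
  closed K -> (forall z, K z -> cmod z <= r) -> K !=set0 -> continuous u ->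
  exists2 z, K z & forall w, K w -> u z <= u w.
Proof.
move=> Kc Kr K0 uc.
have [||z zK zmin] := @compact_EVT_min C R u K K0.
- exact: bounded_closed_compactC Kc Kr.
- exact: continuous_subspaceT.
exists z; first by rewrite inE in zK.
by move=> w Kw; apply: zmin; rewrite inE.
Qed.

Lemma cdiff_cmod_continuous g : (forall z, cdiff g z) -> continuous (fun z => cmod (g z)).
Proof.
move=> gd z; apply: (@continuous_comp C C R g (@cmod R)).
  exact: cdiff_continuous.
exact: cmod_continuous.
Qed.

Lemma cmod_sub_continuous z : continuous (fun w => cmod (w - z)).
Proof.
apply: cdiff_cmod_continuous => w.
exact: cdiffD (cdiff_id _) (cdiff_cst _ _).
Qed.

Lemma closed_level_eq (u : C -> R) x : continuous u -> closed [set z | u z = x].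
Proof.
move=> uc; apply: (@preimage_closed C R u [set x]) => // z _; exact: uc.
Qed.

Lemma closed_level_le (u : C -> R) x : continuous u -> closed [set z | u z <= x].
Proof.
move=> uc; apply: (@preimage_closed C R u [set y | y <= x]) => // z _; exact: uc.
Qed.

Lemma cmod_le_shift z w r : cmod (z - w) <= r -> cmod z <= r + cmod w.
Proof. by move=> H; rewrite -[z](subrK w) (le_trans (cmodD _ _))// lerD2r. Qed.

Lemma cdiff_affine g (a b : C) z : (forall z, cdiff g z) ->
  cdiff (fun w => g (a + b * (w - a))) z.
Proof.
move=> gd; apply: (@cdiff_comp _ (fun w => a + b * (w - a)) g) => //.
apply: cdiffD; first exact: cdiff_cst.
apply: cdiffM; first exact: cdiff_cst.
exact: cdiffD (cdiff_id _) (cdiff_cst _ _).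
Qed.

(** If [cmod (g u) < M], let [z2] be a point nearest to [u] where the modulus is [M]. The square
    about [z2] with one side facing [u] has [g] small on that side, and the product [G] of four
    rotates contradicts [cmod_centre_le]. *)
Lemma local_max_cmod g z1 r : 0 < r -> (forall z, cdiff g z) ->
  (forall z, cmod (z - z1) < r -> cmod (g z) <= cmod (g z1)) ->
  forall u, cmod (u - z1) < r / 8 -> cmod (g u) = cmod (g z1).
Proof.
move=> r0 gd gmax u uz1; set M := cmod (g z1).
apply/eqP; rewrite eq_le [_ <= M]gmax /=; last by lra.
rewrite leNgt; apply/negP => guM.
(* The cut at [r / 2] makes [E] compact, and the disc of radius [d] about [u] stays inside it
   because [d < r / 8]. *)
pose E := [set z | cmod (z - z1) <= r / 2] `&` [set z | cmod (g z) = M].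
have Ec : closed E.
  apply: closedI; first exact: closed_level_le (@cmod_sub_continuous z1).
  exact: closed_level_eq (cdiff_cmod_continuous gd).
have E1 : E z1 by split => //=; rewrite subrr cmod0; lra.
have [z2 [/= z2r z2M] z2min] :
    exists2 z2, E z2 & forall w, E w -> cmod (z2 - u) <= cmod (w - u).
  apply: (@continuous_min E _ (r / 2 + cmod z1) Ec).
  - by move=> z [/= zr _]; exact: cmod_le_shift.
  - by exists z1.
  - exact: cmod_sub_continuous.
set d := cmod (z2 - u) in z2min.
have d1 : d <= cmod (u - z1) by rewrite (cmod_distC u); exact: z2min.
have d0 : 0 < d.
  by rewrite cmod_gt0 subr_eq0; apply: contraTneq guM => <-; rewrite z2M ltxx.
have inside z : cmod (z - u) < d -> cmod (g z) < M.
  move=> zd; have := cmod_triangle u z z1 => tri.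
  rewrite lt_def gmax ?andbT; last by lra.
  apply/eqP => /esym zM; have : E z by split => //=; lra.
  by move=> /z2min; lra.
(* The factor 3/4 lies between the square root of 1/2, which reaches the corners of the facing side,
   and 1, below which [g] stays under [M]. *)
pose K := [set z | cmod (z - u) <= 3 / 4 * d].
have [z3 /= z3d z3max] : exists2 z3, K z3 & forall w, K w -> cmod (g w) <= cmod (g z3).
  apply: (@continuous_max K _ (3 / 4 * d + cmod u)).
  - exact: closed_level_le (@cmod_sub_continuous u).
  - by move=> z /= zr; exact: cmod_le_shift.
  - by exists u; rewrite /K /= subrr cmod0; lra.
  - exact: cdiff_cmod_continuous.
rewrite /K /= in z3d; set q := cmod (g z3) in z3max.
have qM : q < M by apply: inside; lra.
have q0 : 0 <= q by exact: cmod_ge0.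
pose v := u - z2.
have vd : cmod v = d by rewrite /d cmod_distC.
have v0 : v != 0 by rewrite -cmod_gt0 vd.
(* Every boundary point of the square has a rotate by a multiple of a right
   angle on the side facing u, where [g] is small. *)
pose rot (k : nat) z := z2 + i ^+ k * (z - z2).
pose G z := g (rot 0%N z) * g (rot 1%N z) * (g (rot 2%N z) * g (rot 3%N z)).
have Gd z : cdiff G z by do ![apply: cdiffM]; exact: cdiff_affine.
have i4 k : cmod (i ^+ k) = 1 by rewrite cmodX cmod_ci expr1n.
have GM z : on_boundary (corner_of z2 v) v z -> cmod (G z) <= q * M ^+ 3.
  move=> zb.
  have [a [b [zE ab]]] : exists a b : R, z - z2 = v * (a%:C + i * b%:C) /\
     [/\ `|a| <= 1 / 2, `|b| <= 1 / 2 &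
       [\/ a = 1 / 2, a = - (1 / 2), b = 1 / 2 | b = - (1 / 2)]].
    have h1 : `|1 / 2 : R| <= 1 / 2 by rewrite ger0_norm//; lra.
    have h2 : `|- (1 / 2) : R| <= 1 / 2 by rewrite normrN.
    case: zb => t t01 zE.
    have ht : `|t - 1 / 2| <= 1 / 2 by rewrite ler_norml; move/andP: t01 => [? ?]; lra.
    case: zE => ->; rewrite /corner_of.
    + exists (t - 1 / 2), (- (1 / 2)); split; last by split=> //; constructor 4.
      by rewrite !realcE; field.
    + exists (t - 1 / 2), (1 / 2); split; last by split=> //; constructor 3.
      by rewrite !realcE; field.
    + exists (1 / 2), (t - 1 / 2); split; last by split=> //; constructor 1.
      by rewrite !realcE; field.
    + exists (- (1 / 2)), (t - 1 / 2); split; last by split=> //; constructor 2.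
      by rewrite !realcE; field.
  have {ab}[a2 b2 ab] := ab.
  have zd : cmod (z - z2) <= d.
    rewrite zE cmodM vd -[leRHS]mulr1 ler_wpM2l ?(ltW d0)//.
    by apply: (le_trans (cmodD _ _)); rewrite cmodM cmod_ci !cmod_real; lra.
  (* Rotation about [z2] preserves the distance to [z2], so all rotates are within [3 * r / 8] of
     [z1]. *)
  have M0 k : cmod (g (rot k z)) <= M.
    apply: gmax; rewrite /rot addrAC addrC.
    have := cmodD (i ^+ k * (z - z2)) (z2 - z1).
    have := cmod_triangle u z2 z1.
    by rewrite cmodM i4 mul1r -/d; lra.
  have side (b' : R) : `|b'| <= 1 / 2 ->
      cmod (g (z2 + v * ((1 / 2)%:C + i * b'%:C))) <= q.
    move=> b'2; apply: z3max; rewrite /K /mkset.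
    have -> : z2 + v * ((1 / 2)%:C + i * b'%:C) - u = v * ((- (1 / 2))%:C + i * b'%:C).
      by rewrite /v !realcE; field.
    rewrite cmodM vd mulrC ler_wpM2r ?(ltW d0)//.
    have p34 : 0 <= (3 / 4 : R) by lra.
    rewrite -(@ler_pXn2r _ 2)// ?nnegrE ?cmod_ge0//.
    rewrite cmod_sqr /ci; simpc => /=.
    by move: b'2; rewrite ler_norml => /andP[? ?]; nra.
  have [k k4 kq] : exists2 k, (k < 4)%N & cmod (g (rot k z)) <= q.
    have i2 : i ^+ 2 = -1 by rewrite expr2 ci_sqr.
    case: ab => E1'; rewrite /rot zE E1'.
    + by exists 0%N => //; rewrite expr0 mul1r side.
    + exists 2%N => //; rewrite i2.
      rewrite (_ : -1 * _ = v * ((1 / 2)%:C + i * (- b)%:C)).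
        by apply: side; rewrite normrN.
      by rewrite !realcE; ring.
    + exists 3%N => //; rewrite exprS i2.
      rewrite (_ : _ * (v * _) = - v * (i * a%:C + i * i * (1 / 2)%:C)); last by ring.
      rewrite ci_sqr (_ : - v * _ = v * ((1 / 2)%:C + i * (- a)%:C)).
        by apply: side; rewrite normrN.
      by rewrite !realcE; ring.
    + exists 1%N => //; rewrite expr1.
      rewrite (_ : i * (v * _) = v * (i * a%:C + i * i * (- (1 / 2))%:C)); last by ring.
      rewrite ci_sqr (_ : v * _ = v * ((1 / 2)%:C + i * a%:C)).
        exact: side.
      by rewrite !realcE; ring.
  rewrite /G !cmodM.
  have P3 k1 k2 k3 : cmod (g (rot k z)) * (cmod (g (rot k1 z)) *
      (cmod (g (rot k2 z)) * cmod (g (rot k3 z)))) <= q * M ^+ 3.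
    rewrite !exprS expr0 mulr1.
    by do 3![apply: ler_pM; rewrite ?mulr_ge0 ?cmod_ge0//].
  case: k k4 kq P3 => [|[|[|[|]]]] // _ _ P3.
  + by apply: le_trans (P3 1%N 2%N 3%N); rewrite le_eqVlt; apply/orP; left;
      apply/eqP; ring.
  + by apply: le_trans (P3 0%N 2%N 3%N); rewrite le_eqVlt; apply/orP; left;
      apply/eqP; ring.
  + by apply: le_trans (P3 0%N 1%N 3%N); rewrite le_eqVlt; apply/orP; left;
      apply/eqP; ring.
  + by apply: le_trans (P3 0%N 1%N 2%N); rewrite le_eqVlt; apply/orP; left;
      apply/eqP; ring.
have := cmod_centre_le v0 Gd GM.
rewrite /G /rot !subrr !mulr0 !addr0 !cmodM z2M.
have : 0 < M ^+ 3 by rewrite exprn_gt0// (le_lt_trans q0).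
rewrite !exprS expr0 mulr1; nra.
Qed.


Lemma closure_cmod_le (W : set C) r : (forall z, W z -> cmod z <= r) ->
  forall z, closure W z -> cmod z <= r.
Proof.
move=> Wr z Wz; have /closure_id Ec := @closed_cmod_le R r.
have : closure [set z : C | cmod z <= r] z by move: Wz; apply: closure_subset.
by rewrite -Ec.
Qed.

(** Among the maximum points of the modulus on the closure, one of largest real part is chosen. It
    lies in [W], and the modulus is constant near it, so a point slightly to its right is also
    maximal. Connectedness of [W] does not enter. *)
Lemma maximum_principle g (W : set C) r x : (forall z, cdiff g z) ->
  open W -> (forall z, W z -> cmod z <= r) ->
  (forall z, closure W z -> ~ W z -> cmod (g z) < x) ->
  forall z, W z -> cmod (g z) < x.
Proof.
move=> gd Wo Wr bd z Wz; rewrite ltNge; apply/negP => xz.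
have Wcr := closure_cmod_le Wr.
have gc := cdiff_cmod_continuous gd.
have [|z1 z1W z1max] := continuous_max (@closed_closure _ W) Wcr _ gc.
  by exists z; exact: subset_closure.
pose E := closure W `&` [set w | cmod (g w) = cmod (g z1)].
have Ec : closed E.
  by apply: closedI; [exact: closed_closure|exact: closed_level_eq].
have [|||z2 [z2W /= z2M] z2max] := @continuous_max E (@complex.Re R) r Ec.
- by move=> w [Ww _]; exact: Wcr.
- by exists z1.
- move=> w; apply/(@cvgrPdist_lt _ R^o C (nbhs w) (nbhs_filter w)) => e e0.
  apply/nbhs_cmodP; exists e => // v; apply: le_lt_trans.
  rewrite distrC; have [+ _] := ReIm_le_cmod (v - w).
  by case: v w => [a b] [a' b'].
have Wz2 : W z2.
  apply: contrapT => nW; have := bd _ z2W nW.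
  have := z1max _ (subset_closure Wz); rewrite z2M; lra.
have /nbhs_cmodP[d d0 dW] : nbhs z2 W by exact: open_nbhs_nbhs.
have z2lm w : cmod (w - z2) < d -> cmod (g w) <= cmod (g z2).
  by move=> /dW Ww; rewrite z2M; apply: z1max; exact: subset_closure.
have /(_ (z2 + (d / 16)%:C)) := local_max_cmod d0 gd z2lm.
have dist : cmod (z2 + (d / 16)%:C - z2) = d / 16.
  by rewrite addrAC subrr add0r cmod_real ger0_norm// divr_ge0// ltW.
rewrite dist => gz3.
have /z2max : E (z2 + (d / 16)%:C).
  split; first by apply/subset_closure/dW; rewrite dist; lra.
  by rewrite /= gz3// ?z2M//; lra.
by case: (z2) => a b /=; lra.
Qed.

(* [g / (z - c)^n] is entire for every n, and the maximum principle on the disc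
   of radius [2 |w - c|] gives [|g w| * 2^n < M + 1]. *)
Lemma identity_principle g c r : 0 < r -> (forall z, cdiff g z) ->
  (forall z, cmod (z - c) < r -> g z = 0) -> forall z, g z = 0.
Proof.
move=> r0 gd gr w; have [->|wc] := eqVneq w c.
  by apply: gr; rewrite subrr cmod0.
apply/eqP; rewrite -cmod_eq0; apply/eqP.
set s := cmod (w - c); have s0 : 0 < s by rewrite cmod_gt0 subr_eq0.
pose W := [set z | cmod (z - c) < 2 * s].
have Wo : open W.
  apply: (@open_comp C R (fun z => cmod (z - c)) [set y | y < 2 * s]).
    by move=> z _; exact: cmod_sub_continuous.
  exact: open_lt.
have gc := cdiff_cmod_continuous gd.
have Kc : closed [set z | cmod (z - c) <= 2 * s].
  by apply: closed_level_le; exact: cmod_sub_continuous.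
have Kr z : cmod (z - c) <= 2 * s -> cmod z <= 2 * s + cmod c by exact: cmod_le_shift.
have WK z : closure W z -> cmod (z - c) <= 2 * s.
  move=> Wz; have : closure [set z | cmod (z - c) <= 2 * s] z.
    by move: Wz; apply: closure_subset => y /= /ltW.
  by have /closure_id <- := Kc.
have [|m _ mmax] := continuous_max Kc Kr _ gc.
  by exists c; rewrite /= subrr cmod0 mulr_ge0// ltW.
set M := cmod (g m) in mmax.
have key n : cmod (g w) * 2 ^+ n < M + 1.
  pose h z := g z * ((z - c) ^+ n)^-1.
  have hd z : cdiff h z.
    (* [h] vanishes near [c] because [g] does, so the division by zero at [c] is harmless. *)
    have [->|zc] := eqVneq z c.
      apply: (@cdiff_near _ (fun=> 0) _ _ r r0); last exact: cdiff_cst.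
      by move=> y yc; rewrite /h gr// mul0r.
    apply: cdiffM => //; apply: (@cdiffV _ (fun z => (z - c) ^+ n)).
      by rewrite expf_neq0// subr_eq0.
    by apply: cdiffX; exact: cdiffD (cdiff_id _) (cdiff_cst _ _).
  have p2 : 0 < (2 * s) ^+ n by rewrite exprn_gt0// mulr_gt0.
  have : cmod (h w) < (M + 1) / (2 * s) ^+ n.
    apply: (maximum_principle hd Wo (r := 2 * s + cmod c)).
    - by move=> z /ltW; exact: Kr.
    - move=> z Wz nWz; have zK := WK _ Wz.
      have zs : cmod (z - c) = 2 * s.
        by apply/eqP; rewrite eq_le zK leNgt; apply/negP.
      rewrite /h cmodM cmodV cmodX zs ltr_pM2r ?invr_gt0//.
      by have := mmax _ zK; lra.
    - by rewrite /W /= -/s; lra.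
  rewrite /h cmodM cmodV cmodX -/s ltr_pdivlMr// exprMn.
  have sn : s ^+ n != 0 by rewrite gt_eqF// exprn_gt0.
  by rewrite (mulrC (2 ^+ n)) -mulrA mulKf.
apply/eqP; rewrite eq_le cmod_ge0 andbT leNgt; apply/negP => gw0.
pose n := (Num.truncn ((M + 1) / cmod (g w))).+1.
have nM : M + 1 < n%:R * cmod (g w) by rewrite -ltr_pdivrMr//; exact: truncnS_gt.
have n2 : (n%:R : R) <= 2 ^+ n by rewrite -natrX ler_nat ltnW// ltn_expl.
by have := key n; nra.
Qed.

(* The moduli of both [f] and [f + f z1] have a local maximum at [z1]; where they
   are constant, the parallelogram law gives [f z = f z1]. *)
Lemma local_max_cst f z1 r : 0 < r -> (forall z, cdiff f z) ->
  (forall z, cmod (z - z1) < r -> cmod (f z) <= cmod (f z1)) ->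
  forall z, f z = f z1.
Proof.
move=> r0 fd fmax.
have f1 := local_max_cmod r0 fd fmax.
pose F z := f z + f z1.
have Fd z : cdiff F z by exact: cdiffD (cdiff_cst _ _).
have F1 : cmod (F z1) = 2 * cmod (f z1).
  rewrite (_ : F z1 = 2%:R * f z1); last by rewrite /F; ring.
  by rewrite cmodM cmod_nat.
have Fmax z : cmod (z - z1) < r -> cmod (F z) <= cmod (F z1).
  move=> /fmax zr; rewrite F1; have := cmodD (f z) (f z1); lra.
have F2 := local_max_cmod r0 Fd Fmax.
have r8 : 0 < r / 8 by lra.
have H : forall z, f z - f z1 = 0.
  apply: (@identity_principle (fun z => f z - f z1) z1 _ r8).
    by move=> z; exact: cdiffD (cdiff_cst _ _).
  move=> z zr; apply/eqP; rewrite -cmod_eq0 -sqrf_eq0.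
  have para (a b : C) : cmod (a - b) ^+ 2 =
      2 * cmod a ^+ 2 + 2 * cmod b ^+ 2 - cmod (a + b) ^+ 2.
    by rewrite !cmod_sqr; case: a b => [a1 a2] [b1 b2] /=; ring.
  by rewrite para F2// F1 f1//; apply/eqP; ring.
by move=> z; apply/eqP; rewrite -subr_eq0 H.
Qed.

(** The maximum over the closed disc is not attained inside for nonconstant [f]; hence it is
    attained on the circle, strictly above all inner values. *)
Lemma cmod_lt_maxmod f w t : (forall z, cdiff f z) ->
  ~ (forall z, f z = f w) -> cmod w < t -> cmod (f w) < maxmod f t.
Proof.
move=> fd fnc wt; rewrite ltNge; apply/negP => Mw.
have t0 : 0 < t by exact: le_lt_trans (cmod_ge0 _) wt.
have fc := cdiff_cmod_continuous fd.
have [|m mt mmax] := continuous_max (@closed_cmod_le R t) (fun z H => H) _ fc.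
  by exists 0; rewrite /= cmod0 ltW.
(* The supremum is an upper bound only once the set is known to be bounded; the maximum over the
   disc bounds it. *)
have bdle z : cmod z = t -> cmod (f z) <= maxmod f t.
  move=> zt; rewrite /maxmod; apply: ub_le_sup; last by exists z.
  by exists (cmod (f m)) => _ [y /= yt <-]; apply: mmax; rewrite /= yt.
have inner p : cmod p < t -> cmod (f p) < cmod (f m).
  move=> pt; rewrite lt_def mmax /= ?(ltW pt)// andbT; apply/eqP => pm.
  have lm : forall z, f z = f p.
    apply: (@local_max_cst f p (t - cmod p)); rewrite ?subr_gt0// => z zp.
    rewrite -pm; apply: mmax => /=.
    by rewrite -[z](subrK p) (le_trans (cmodD _ _))//; lra.
  by apply: fnc => z; rewrite !lm.
have := inner _ wt; have [mlt|] := ltP (cmod m) t.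
  by have := inner _ mlt; rewrite ltxx.
move=> tm; have : cmod m = t by apply/eqP; rewrite eq_le mt.
by move/bdle; lra.
Qed.

End MaximumPrinciple.

(** * Quasi-components of compact sets and boundary bumping *)

Section BoundaryBumping.
Variable R : realType.
Local Notation C := (Cplx R).
Implicit Types (A B K F Q U W : set C) (z w : C) (r : R).

Lemma open_cmodP U : open U <->
  forall z, U z -> exists2 e : R, 0 < e & forall w, cmod (w - z) < e -> U w.
Proof.
rewrite openE; split=> [Uo z /Uo /nbhs_cmodP//|H z /H Uz].
exact/nbhs_cmodP.
Qed.

Lemma closed_setD A U : closed A -> open U -> closed (A `\` U).
Proof. by move=> Ac Uo; rewrite setDE; apply: closedI => //; exact: open_closedC. Qed.

(** Balls about the points of each set, with radius at most half the distance to the other set,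
    cannot meet. *)
Lemma separate_closed A B : closed A -> closed B -> A `&` B = set0 ->
  exists U V, [/\ open U, open V, A `<=` U, B `<=` V & U `&` V = set0].
Proof.
move=> Ac Bc AB.
pose N D E := [set z : C | exists a, exists e : R,
  [/\ D a, forall b, E b -> 2 * e <= cmod (b - a) & cmod (z - a) < e]].
have No D E : open (N D E).
  apply/open_cmodP => z [a [e [Da De ze]]]; exists (e - cmod (z - a)).
    by rewrite subr_gt0.
  move=> w wz; exists a, e; split => //.
  by have := cmod_triangle z w a; lra.
have DN D E : closed E -> D `&` E = set0 -> D `<=` N D E.
  move=> Ec DE a Da.
  have nEa : (~` E) a.
    by move=> Ea; have : (D `&` E) a by []; rewrite DE.
  have [e e0 eE] := (open_cmodP _).1 (closed_openC Ec) a nEa.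
  exists a, (e / 2); split => //; last by rewrite subrr cmod0; lra.
  by move=> b Eb; rewrite leNgt; apply/negP => be; apply: (eE b) Eb; lra.
exists (N A B), (N B A); split; [exact: No|exact: No|exact: DN| |].
  by apply: DN; rewrite // setIC.
rewrite -subset0 => z [[a [e [Aa ae ze]]] [b [d [Bb bd zd]]]].
have := ae b Bb; have := bd a Aa; have := cmod_triangle z a b.
by rewrite (cmod_distC b a) (cmod_distC a z); lra.
Qed.

(* The relatively clopen subsets of [K] around [z], for [K] closed. *)
Definition clopen_part K z F := [/\ F z, F `<=` K, closed F & closed (K `\` F)].

Lemma clopen_partI K z F1 F2 :
  clopen_part K z F1 -> clopen_part K z F2 -> clopen_part K z (F1 `&` F2).
Proof.
move=> [z1 K1 c1 d1] [z2 K2 c2 d2]; split => //.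
- by move=> w [/K1].
- exact: closedI.
- by rewrite setDIr; exact: closedU.
Qed.

Definition quasi_component K z := [set w | forall F, clopen_part K z F -> F w].

(** The complements of the clopen parts cover the compact set [K] minus [U]; clopen parts are stable
    under intersection, so one of them already avoids it. *)
Lemma quasi_component_open K z U : compact K -> closed K -> K z -> open U ->
  quasi_component K z `<=` U -> exists2 F, clopen_part K z F & F `<=` U.
Proof.
move=> Kco Kc Kz Uo QU.
have KU : compact (K `\` U).
  by apply: (subclosed_compact _ Kco); [exact: closed_setD|exact: subDsetl].
(* The filter of all sufficiently small clopen parts takes the place of a finite subcover. *)
pose Fil := [set S : set (set C) | exists2 F, clopen_part K z F &
  forall F', clopen_part K z F' -> F' `<=` F -> S F'].
have FilF : Filter Fil.
  split.
  - exists K => //; split => //; rewrite setDv; exact: closed0.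
  - move=> S1 S2 [F1 p1 H1] [F2 p2 H2]; exists (F1 `&` F2); first exact: clopen_partI.
    move=> F' p' F'F; split; [apply: H1|apply: H2] => // w /F'F[] //.
  - by move=> S1 S2 S12 [F p H]; exists F => // F' p' F'F; exact/S12/H.
have [x [Kx nUx]|F pF FP] :=
    (compact_near_coveringP _).1 KU _ Fil (fun F w => ~ F w) FilF.
  have : ~ quasi_component K z x by move=> /QU.
  move=> /existsNP[F /not_implyP[pF nFx]].
  exists (~` F, [set F' | clopen_part K z F' /\ F' `<=` F]).
    split => /=; last by exists F.
    by apply: open_nbhs_nbhs; split => //; case: pF => _ _ /closed_openC.
  by move=> [w F'] /= [nFw [_ F'F]] /F'F.
exists F => // w Fw; apply: contrapT => nUw.
have [_ FK _ _] := pF.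
by apply: (FP F pF (fun _ h => h) w) => //; split => //; exact: FK.
Qed.

(** A separation of [Q] extends to disjoint open sets [U], [V] covering some clopen part. Its trace
    on the open set around the half containing [z] is again a clopen part, yet misses the other
    half. *)
Lemma quasi_component_connected K z : compact K -> closed K -> K z ->
  connected (quasi_component K z).
Proof.
move=> Kco Kc Kz; set Q := quasi_component K z.
have Qc : closed Q.
  have -> : Q = \bigcap_(F in clopen_part K z) F by [].
  by apply: closed_bigI => F [].
have Qz : Q z by move=> F [].
apply: contrapT => /connectedPn[E [E0 QE [s1 s2]]].
have Qsub b : E b `<=` Q by rewrite QE; case: b => w; [right|left].
have Ecl b : closed (E b).
  rewrite closure_id; apply/seteqP; split; first exact: subset_closure.
  move=> w Ew; have : Q w.
    by rewrite closure_id in Qc; rewrite Qc; move: Ew; apply: closure_subset.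
  rewrite QE; case: b Ew => Ew [] // Ew'; exfalso.
    by have : (E false `&` closure (E true)) w by []; rewrite s2.
  by have : (closure (E false) `&` E true) w by []; rewrite s1.
have Edisj : E false `&` E true = set0.
  by rewrite -subset0 => w [Ef Et]; rewrite -s1; split => //; exact: subset_closure.
have main b : ~ E b z.
  move=> Ez.
  have [U [V [Uo Vo EU EV UV]]] : exists U V, [/\ open U, open V, E b `<=` U,
      E (~~ b) `<=` V & U `&` V = set0].
    by apply: separate_closed => //; case: (b) => //=; rewrite setIC.
  have [|F [Fz FK Fc KFc] FUV] :=
      @quasi_component_open K z (U `|` V) Kco Kc Kz (openU Uo Vo).
    by move=> w; rewrite -/Q QE => -[] Ew; case: (b) EU EV => EU EV;
      [right; exact: EV|left; exact: EU|left; exact: EU|right; exact: EV].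
  have disj w : U w -> V w -> False.
    by move=> Uw Vw; have : (U `&` V) w by []; rewrite UV.
  (* This identity makes the trace closed as well as relatively open. *)
  have FU : F `&` U = F `\` V.
    apply/seteqP; split => w [Fw Uw]; split => //; first by move=> Vw; exact: disj Vw.
    by case: (FUV w Fw).
  have pFU : clopen_part K z (F `&` U).
    split.
    - by split => //; exact: EU.
    - by move=> w [/FK].
    - by rewrite FU; exact: closed_setD.
    - have -> : K `\` (F `&` U) = (K `\` F) `|` (F `\` U).
        rewrite setDIr; apply/seteqP; split => w [].
        + by left.
        + move=> [Kw nUw]; have [Fw|nFw] := pselect (F w); [by right|by left].
        + by left.
        + by move=> [Fw nUw]; right; split => //; exact: FK.
      by apply: closedU => //; exact: closed_setD.
  have [y Ey] := E0 (~~ b).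
  have [_ Uy] := Qsub _ _ Ey _ pFU.
  by apply: (disj y) => //; exact: EV.
by move: Qz; rewrite QE => -[]; exact: main.
Qed.

(** The quasi-component of [z] in [K] is connected, hence inside the component and at distance 1
    from the rim of the disc. Some clopen part [F] therefore stays inside the open disc, and [W] is
    a neighbourhood of [F] away from the rest of [K]. *)
Lemma bounded_component_isolated A z r : closed A -> A z ->
  (forall w, connected_component A z w -> cmod w <= r) ->
  exists W, [/\ open W, W z, forall w, W w -> cmod w <= r + 1 &
    forall w, closure W w -> ~ W w -> ~ A w].
Proof.
move=> Ac Az comp_r.
pose K := A `&` [set w | cmod w <= r + 1].
have Kc : closed K by apply: closedI => //; exact: closed_cmod_le.
have Kco : compact K by apply: (bounded_closed_compactC Kc (r := r + 1)) => w [].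
have zr : cmod z <= r by apply: comp_r; exact: connected_component_refl.
have Kz : K z by split => //=; lra.
pose D := [set w : C | cmod w < r + 1].
have Do : open D.
  apply: (@open_comp C R (@cmod R) [set y | y < r + 1]); last exact: open_lt.
  by move=> w _; exact: cmod_continuous.
have [|F [Fz FK Fc KFc] FD] := @quasi_component_open K z D Kco Kc Kz Do.
  move=> w Qw; suff : cmod w <= r by rewrite /D /=; lra.
  apply: comp_r; apply: (@connected_component_max _ A (quasi_component K z)) => //.
  - by move=> F [].
  - move=> v Qv; have : K v.
      by apply: (Qv K); split => //; rewrite setDv; exact: closed0.
    by case.
  - exact: quasi_component_connected.
(* Separating [F] from the complement of [D] too keeps the closure of [W] inside [D], where [A] and
   [K] agree. *)
have [|U [V [Uo Vo FU BV UV]]] := @separate_closed F ((K `\` F) `|` ~` D) Fc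
    (closedU KFc (open_closedC Do)).
  by rewrite -subset0 => w [Fw [[]|]] //; apply; exact: FD.
exists (U `&` D); split; [exact: openI| | |].
- by split; [exact: FU|exact: FD].
- by move=> w [_ /ltW].
- move=> w Ww nWw Aw.
  have nVw : ~ V w.
    move=> Vw; have [x [[Ux _] Vx]] := Ww V (open_nbhs_nbhs (conj Vo Vw)).
    by have : (U `&` V) x by []; rewrite UV.
  have Dw : D w by apply: contrapT => nDw; apply/nVw/BV; right.
  have nFw : ~ F w by move=> Fw; apply: nWw; split => //; exact: FU.
  by apply/nVw/BV; left; split => //; split => //; exact: ltW.
Qed.

End BoundaryBumping.

(** * Components of the levels and of the fast escaping set *)

Section Levels.
Variables (R : realType) (f : Cplx R -> Cplx R) (r0 : R).
Hypothesis fT : transcendental_entire f.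
Local Notation C := (Cplx R).
Local Notation M n := (maxmod_iter f n r0).
Implicit Types (L : int) (z w : C).

Let fd z : cdiff f z.
Proof. by have [fe _] := fT; exact/derivable_cdiff/fe. Qed.

Let f_nonconstant w : ~ (forall z, f z = f w).
Proof.
move=> fw; have [_] := fT; apply; exists (f w)%:P => z.
by rewrite hornerC.
Qed.

Let iterd n z : cdiff (iter n f) z.
Proof.
elim: n z => [|n IH] z; first exact: cdiff_id.
exact: (@cdiff_comp _ (iter n f) f z).
Qed.

(** An orbit that has fallen below the iterated maximum modulus stays below it. *)
Lemma cmod_iter_lt n m k z : cmod (iter n f z) < M m ->
  cmod (iter (n + k) f z) < M (m + k).
Proof.
move=> nm; elim: k => [|k IH]; first by rewrite !addn0.
rewrite !addnS; exact: cmod_lt_maxmod fd (@f_nonconstant _) IH.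
Qed.

Lemma closed_level L : closed (level f r0 L).
Proof.
have -> : level f r0 L = \bigcap_(n in [set n : nat | (1 <= n)%N /\ 0 <= n%:Z + L])
    [set z | M (absz (n%:Z + L)) <= cmod (iter n f z)].
  apply/seteqP; split => [z zL n [n1 nL]|z zL n n1 nL]; first exact: zL.
  exact: (zL n (conj n1 nL)).
apply: closed_bigI => n _.
apply: (@preimage_closed C R (fun z => cmod (iter n f z)) [set y | _ <= y]) => // z _.
by apply: cdiff_cmod_continuous => w; exact: iterd.
Qed.

Lemma level_component_unbounded L z : level f r0 L z ->
  ~ bounded_set (connected_component (level f r0 L) z).
Proof.
move=> zL /bounded_cmodP[r comp_r].
have [W [Wo Wz Wr bdW]] := bounded_component_isolated (@closed_level L) zL comp_r.
pose B := closure W `\` W.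
have Bco : compact B.
  apply: (@bounded_closed_compactC _ B (r + 1)).
    by apply: closed_setD => //; exact: closed_closure.
  by move=> w [Ww _]; exact: (closure_cmod_le Wr).
pose P (n : nat) w := cmod (iter n f w) < M (absz (n%:Z + L)).
have [x [Wx nWx]|N _ NP] := (compact_near_coveringP _).1 Bco _ \oo P _.
  have /existsNP[n /not_implyP[n1 /not_implyP[nL /negP]]] := bdW x Wx nWx.
  rewrite -ltNge => xn.
  (* Failure of condition [n] is open in the point and inherited by all later indices, which gives
     one index valid on all of [B]. *)
  exists ([set w | P n w], [set m | (n <= m)%N]).
    split => /=; last by exists n.
    apply: open_nbhs_nbhs; split => //.
    apply: (@open_comp C R (fun z => cmod (iter n f z)) [set y | y < _]).
      by move=> w _; apply: cdiff_cmod_continuous => v; exact: iterd.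
    exact: open_lt.
  move=> [w m] /= [wn nm].
  have := cmod_iter_lt (m - n) wn; rewrite subnKC// /P.
  by congr (_ < M _); lia.
(* This [n] is at least [N], is positive, and satisfies [0 <= n + L]. *)
pose n := (N + absz L + 1)%N.
have nP w : closure W w -> ~ W w -> cmod (iter n f w) < M (absz (n%:Z + L)).
  by move=> Ww nWw; apply: (NP n) => //=; rewrite /n; lia.
have := maximum_principle (iterd n) Wo Wr nP Wz.
rewrite ltNge; apply/negP; rewrite negbK.
by apply: zL; rewrite /n; lia.
Qed.

Lemma level_fast_escaping (L : nat) : (1 <= L)%N ->
  level f r0 (- L%:Z) `<=` fast_escaping f r0.
Proof.
move=> L1 z zL; exists L => // n n1.
have := zL (n + L)%N.
have -> : absz ((n + L)%N%:Z - L%:Z) = n by lia.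
by apply; lia.
Qed.

(** The level also imposes the condition with exponent 0, at [n = L], which [fast_escaping] omits. A
    failure at [n] would persist to [n + 1], where the exponent is positive. *)
Lemma fast_escaping_level z : fast_escaping f r0 z ->
  exists2 L : nat, (1 <= L)%N & level f r0 (- L%:Z) z.
Proof.
move=> [L L1 zL]; exists L => // n n1 nL.
rewrite leNgt; apply/negP => /(cmod_iter_lt 1%N) H.
have := zL (n - L + 1)%N; rewrite leNgt.
have -> : (n - L + 1 + L = n + 1)%N by lia.
have -> : (n - L + 1 = absz (n%:Z - L%:Z) + 1)%N by lia.
by rewrite H addn1 => /(_ isT).
Qed.

End Levels.

Unset Implicit Arguments.

Theorem theorem1p1 (R : realType) (f : Cplx R -> Cplx R) (r0 : R) :
  transcendental_entire f ->
  0 < r0 ->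
  (forall r : R, r0 <= r -> r < maxmod f r) ->
  (forall (L : int) (C : set (Cplx R)),
     components (level f r0 L) C -> closed C /\ ~ bounded_set C) /\
  (forall C : set (Cplx R),
     components (fast_escaping f r0) C -> ~ bounded_set C).
Proof.
move=> fT _ _; split=> [L _ [z zL <-]|_ [z zA <-]].
  split; first exact/component_closed/closed_level.
  exact: level_component_unbounded.
(* The component of [z] in this level is a connected subset of the fast escaping set, so a bound on
   the larger component would bound it. *)
have [L L1 zL] := fast_escaping_level fT zA.
move=> /bounded_cmodP[r rP]; apply: (level_component_unbounded fT zL).
apply/bounded_cmodP; exists r => w [B [Bz BL Bco] Bw]; apply: rP.
exists B => //; split => //.
exact: subset_trans BL (level_fast_escaping L1).
Qed.
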